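(* Let $d\in\mathcal{P}_{\mathcal{G}}^{0}$, $h\in\mathcal{P}_{\mathcal{H}}$ and $\kappa,\sigma\in\{0,1\}$. Then $\xi=\xi_\gamma\xi_g$ and $\xi^2$ act on $4096_x$ by \begin{align*} (g_0^{\kappa}dh)_1^{[\sigma]}&\ \stackrel{\xi}{\longmapsto}\ \tfrac14\sum_{e\in\mathcal{P}_{\mathcal{G}}^{0}}(-1)^{\langle\!\langle d,e\rangle\!\rangle+w_2(e)+1}\,(g_0^{\sigma}eh)_1^{[\kappa+\sigma+1]},\\ (g_0^{\kappa}dh)_1^{[\sigma]}&\ \stackrel{\xi^2}{\longmapsto}\ \tfrac14\sum_{e\in\mathcal{P}_{\mathcal{G}}^{0}}(-1)^{\langle\!\langle d,e\rangle\!\rangle+w_2(d)+1}\,(g_0^{\kappa+\sigma+1}eh)_1^{[\kappa]}. \end{align*}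
   Context: All actions are from the right (so $\xi=\xi_\gamma\xi_g$ means first $\xi_\gamma$, then $\xi_g$). Golay code. Let $\mathbb{F}_4=\{0,1,\alpha,\bar\alpha\}$, $\alpha^2=\bar\alpha=1+\alpha$, and let $\mathcal{H}_6\subset\mathbb{F}_4^6$ be the $\mathbb{F}_4$-span of $(1,0,0,1,\bar\alpha,\alpha),(0,1,0,1,\alpha,\bar\alpha),(0,0,1,1,1,1)$. Let $\tilde\Omega=\{0,\dots,23\}$, arranged in an array (MOG) with rows $0,\dots,3$ and columns $0,\dots,5$, the element $m+4n$ being in row $m$, column $n$; rows $0,1,2,3$ carry labels $0,1,\alpha,\bar\alpha$. Subsets of $\tilde\Omega$ are identified with vectors in $\mathbb{F}_2^{24}$. For $x\in\mathbb{F}_2^{24}$, $\mathfrak h(x)\in\mathbb{F}_4^6$ has $n$-th coordinate the sum of the labels of the rows in which $x$ has an entry $1$ in column $n$. $\mathcal{C}$ is the set of $x$ with $\mathfrak h(x)\in\mathcal{H}_6$ such that the parity of $x$ in every column equals its parity in row $0$; it is a Golay code. $\mathcal{C}^*=\mathbb{F}_2^{24}/\mathcal{C}$, with pairing $\langle d,\delta\rangle=|d\cap\delta|\bmod 2$ on $\mathcal{C}\times\mathcal{C}^*$; the parity of $\delta\in\mathcal{C}^*$ is the parity of the size of any representative. Grey and coloured parts. $\mathcal{G}\subset\mathcal{C}$: code words whose entries in rows 1,2,3 agree in each column. $\mathcal{H}\subset\mathcal{C}$: code words with zeros in row 0 and $0$ or $2$ ones in each column. $\mathcal{C}=\mathcal{G}\oplus\mathcal{H}$.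 $\mathcal{G}^*\subset\mathcal{C}^*$ is the orthogonal complement of $\mathcal{H}$. $\mathcal{G}$ has basis $g_0,\dots,g_5$, where $g_i$ has ones exactly in rows 1,2,3 of column $i$ and in row 0 of the columns $\ne i$. $\mathcal{G}^*$ has basis $\gamma_0,\dots,\gamma_5$, with $\gamma_i$ the class of the element in row 0, column $i$. $\omega=\sum_i\gamma_i$. $w$ is the weight (number of nonzero coefficients) with respect to these bases on $\mathcal{G}$ resp. $\mathcal{G}^*$, and $w_2=\binom{w}{2}\bmod 2$. $\gamma:\mathcal{C}\to\mathcal{G}^*$, $\gamma(d)$ = sum of those $\gamma_i$ for which $d$ has at least two ones in rows 1,2,3 of column $i$. For $d,e\in\mathcal{G}$, $\langle\!\langle d,e\rangle\!\rangle=\langle d,\gamma(e)\rangle=\langle e,\gamma(d)\rangle$. Parker loop. $P(d)=\frac14|d|$, $C(d,e)=\frac12|d\cap e|$, $A(d,e,f)=|d\cap e\cap f|$ (mod 2); $A(d,e)\in\mathcal{C}^*$ is the class of $d\cap e$. Fix $\theta:\mathcal{C}\times\mathcal{C}\to\mathbb{F}_2$ with $\theta(d,d)=P(d)$, $\theta(d,e)+\theta(e,d)=C(d,e)$, $\theta(d+e,f)=\theta(d,f)+\theta(e,f)+A(d,e,f)$, $\theta(d,e+f)=\theta(d,e)+\theta(d,f)$; let $\theta(d)\in\mathcal{C}^*$ be given by $\langle e,\theta(d)\rangle=\theta(d,e)$. Moreover $\theta(d+\tilde\Omega)=\theta(d)$ for $d\in\mathcal{C}$; $\theta(e)=(w(e)-1)\gamma(e)+w_2(e)\omega$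 for $e\in\mathcal{G}$; $\theta(e,h)=0$ and $\theta(h,e)=\langle e,\gamma(h)\rangle$ for $e\in\mathcal{G},h\in\mathcal{H}$. The Parker loop is $\mathcal{P}=\mathcal{C}\times\mathbb{F}_2$ with $(d,\lambda)(e,\mu)=(d+e,\lambda+\mu+\theta(d,e))$; $-1=(0,1)$, $\Omega=(\tilde\Omega,0)$; $\bar d$ is the inverse of $d$. Functions on $\mathcal{C}$ are applied to $\mathcal{P}$ via projection. $\mathcal{P}_{\mathcal{H}}$ is the preimage of $\mathcal{H}$ in $\mathcal{P}$; $g_i$ also denotes $(g_i,0)\in\mathcal{P}$ (so $g_0^2=1$); $\mathcal{P}_{\mathcal{G}}^0=\{(\sum_{i=1}^5\alpha_ig_i,0)\mid\alpha_i\in\{0,1\},\ \sum_{i=1}^5\alpha_i\equiv0\bmod 2\}$ (16 elements). The products $g_0^\kappa dh$ (with $d\in\mathcal{P}_{\mathcal{G}}^0$, $h\in\mathcal{P}_{\mathcal{H}}$) do not depend on the bracketing. $Q_x$ and $4096_x$. $Q_x$ is the group of order $2^{25}$ generated by $x_d$ ($d\in\mathcal{P}$), $x_\delta$ ($\delta\in\mathcal{C}^*$) with $x=x_{-1}$ central and defining relations $x_d^2=x^{P(d)}$, $x_\delta^2=1$, $x_dx_e=x_{de}x_{A(d,e)}$, $x_\delta x_\epsilon=x_{\delta+\epsilon}$, $[x_d,x_\delta]=x^{\langle d,\delta\rangle}$. $4096_x$ is the real vector space of dimension 4096 spanned by vectors $d_1^+,d_1^-$ ($d\in\mathcal{P}$),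 subject exactly to $(-d)_1^\pm=-d_1^\pm$, $(\Omega d)_1^+=d_1^+$, $(\Omega d)_1^-=-d_1^-$. $Q_x$ acts by $x_e:d_1^\pm\mapsto(\bar ed)_1^\pm$, and $x_\delta:d_1^\pm\mapsto(-1)^{\langle d,\delta\rangle}d_1^\pm$ for even $\delta$, $d_1^\pm\mapsto(-1)^{\langle d,\delta\rangle}d_1^\mp$ for odd $\delta$. For $\sigma\in\mathbb{Z}$, $d_1^{[\sigma]}=d_1^+$ if $\sigma$ is even and $d_1^-$ if $\sigma$ is odd. Put $\tilde x_d=x_{(d,0)}x_{\theta(d)}$ for $d\in\mathcal{C}$ and $$\xi_\gamma=\tfrac18\sum_{\epsilon\in\mathcal{G}^*}(-1)^{w_2(\epsilon)}x_\epsilon,\quad \xi_g=\tfrac18\sum_{e\in\mathcal{G}}(-1)^{w_2(e)}\tilde x_e,$$ regarded as linear operators on $4096_x$. *)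

(* Defs.v *)
From HB Require Import structures.
From mathcomp Require Import all_boot all_order all_algebra all_fingroup.
From mathcomp Require Import qpoly qfpoly mxrepresentation.
From mathcomp Require Import generic_quotient ring_quotient.
From mathcomp Require Import reals.

Set Implicit Arguments.
Unset Strict Implicit.
Unset Printing Implicit Defensive.

Import Order.TTheory GRing.Theory Num.Theory.

Local Open Scope ring_scope.
Local Open Scope quotient_scope.

Definition F4_poly : {poly 'F_2} := 'X^2 + 'X + 1.

Lemma F2_case (x : 'F_2) : x = 0 \/ x = 1.
Proof. by case: x => [[|[|//]] i]; [left | right]; apply: val_inj. Qed.

Lemma size_F4_poly : size F4_poly = 3.
Proof.
by rewrite /F4_poly -addrA size_polyDl size_polyXn // -polyC1 size_XaddC.
Qed.

Lemma F4_polyP : monic_irreducible_poly F4_poly.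
Proof.
split.
  apply: cubic_irreducible; first by rewrite size_F4_poly.
  by move=> x; rewrite rootE !hornerE; case: (F2_case x) => ->.
by rewrite monicE lead_coefE size_F4_poly /F4_poly !coefE.
Qed.

Definition F4 : fieldType := {poly %/ F4_poly with F4_polyP}.
Definition alpha : F4 := 'qX : {poly %/ F4_poly}.

Definition hexacode : {vspace 'rV[F4]_6} :=
  <<[:: \row_(j < 6) [:: 1; 0; 0; 1; alpha ^+ 2; alpha]`_j;
        \row_(j < 6) [:: 0; 1; 0; 1; alpha; alpha ^+ 2]`_j;
        \row_(j < 6) [:: 0; 0; 1; 1; 1; 1]`_j]>>%VS.

Lemma mog_subproof (m : 'I_4) (n : 'I_6) : (m + 4 * n < 24)%N.
Proof. by case: m n => [[|[|[|[|//]]]] ?] [[|[|[|[|[|[|//]]]]]] ?]. Qed.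

Definition mog (m : 'I_4) (n : 'I_6) : 'I_24 := Ordinal (mog_subproof m n).

Definition row_label (m : 'I_4) : F4 := [:: 0; 1; alpha; alpha ^+ 2]`_m.

Notation vec := 'rV['F_2]_24.

Definition entry (x : vec) (m : 'I_4) (n : 'I_6) : 'F_2 := x 0 (mog m n).
Definition wt (x : vec) : nat := #|[set i | x 0 i != 0]|.
Definition cap (x y : vec) : vec := \row_i (x 0 i * y 0 i).

Definition hexa (x : vec) : 'rV[F4]_6 :=
  \row_n \sum_(m | entry x m n == 1) row_label m.

Definition golay : {pred vec} := [pred x |
  (hexa x \in hexacode) &&
  [forall n, \sum_m entry x m n == \sum_k entry x ord0 k]].

Lemma F4_addxx (a : F4) : a + a = 0.
Proof.
rewrite -mulr2n -mulr_natr -[2%:R](rmorph_nat (in_qpoly F4_poly)).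
by rewrite -polyC_natr (_ : 2%:R = 0 :> 'F_2) ?rmorph0 ?mulr0 //; apply: val_inj.
Qed.

Lemma hexaB x y : hexa (x - y) = hexa x - hexa y.
Proof.
apply/rowP=> n; rewrite !mxE !(big_mkcond (fun m => _ == 1)) /= -sumrB.
have E m : (if entry (x - y) m n == 1 then row_label m else 0) =
  (if entry x m n == 1 then row_label m else 0) -
  (if entry y m n == 1 then row_label m else 0).
  rewrite /entry !mxE.
  case: (F2_case (x 0 (mog m n))) => ->; case: (F2_case (y 0 (mog m n))) => ->;
    rewrite ?subr0 ?sub0r ?subrr ?eqxx //=.
  by apply/eqP; rewrite -addr_eq0 F4_addxx.
by under eq_bigr do rewrite E.
Qed.

Lemma golay_zmod_closed : zmod_closed golay.
Proof.
split=> [|x y].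
  rewrite inE -[X in hexa X](subrr 0) hexaB subrr mem0v /=.
  by apply/forallP=> n; rewrite !big1 // => i _; rewrite /entry mxE.
rewrite !inE => /andP[hx /forallP px] /andP[hy /forallP py].
rewrite hexaB rpredB //=; apply/forallP=> n.
have E m k : entry (x - y) m k = entry x m k - entry y m k by rewrite /entry !mxE.
under eq_bigr do rewrite E.
under [X in _ == X]eq_bigr do rewrite E.
by rewrite !sumrB (eqP (px n)) (eqP (py n)).
Qed.

HB.instance Definition _ := GRing.isZmodClosed.Build vec golay golay_zmod_closed.

Record code := Code { code_val :> vec; code_valP : code_val \in golay }.

HB.instance Definition _ := [isSub for code_val].
HB.instance Definition _ := [Finite of code by <:].
HB.instance Definition _ := [SubChoice_isSubZmodule of code by <:].

Definition cocode : Type := {ideal_quot golay}.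
HB.instance Definition _ := GRing.Zmodule.on cocode.
HB.instance Definition _ := EqQuotient.on cocode.
HB.instance Definition _ : isCountable cocode :=
  CanIsCountable (@reprK _ cocode).
HB.instance Definition _ : isFinite cocode := CanIsFinite (@reprK _ cocode).

Definition coclass (x : vec) : cocode := \pi_cocode x.

(* repr picks a representative; as golay is self-dual, with words of even
   weight, pairing and coparity do not depend on it. *)
Definition pairing (d : code) (delta : cocode) : 'F_2 :=
  (wt (cap d (repr delta)))%:R.
Definition coparity (delta : cocode) : bool := odd (wt (repr delta)).

Lemma F4_sum_labels : alpha + alpha ^+ 2 = 1.
Proof.
have /eqP : alpha ^+ 2 + alpha + 1 = 0.
  rewrite -[1](rmorph1 (in_qpoly F4_poly)) -[alpha]/(in_qpoly F4_poly 'X).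
  rewrite -[_ ^+ 2](rmorphXn (in_qpoly F4_poly)) -!rmorphD /=.
  apply/val_inj => /=; rewrite (mk_monicE F4_polyP).
  by rewrite Pdiv.RingMonic.rmodpp //; exact: F4_polyP.2.
rewrite addr_eq0 addrC -subr_eq0 opprK => /eqP h.
by rewrite -[RHS]add0r -h -addrA F4_addxx addr0.
Qed.

Lemma allone_golay : (const_mx 1 : vec) \in golay.
Proof.
rewrite inE; apply/andP; split.
  rewrite (_ : hexa _ = 0) ?mem0v //; apply/rowP=> n; rewrite !mxE.
  under eq_bigl do rewrite /entry mxE eqxx.
  rewrite !big_ord_recl big_ord0 /= /row_label /= add0r addr0.
  by rewrite -[X in _ + X]/(alpha + alpha ^+ 2) F4_sum_labels F4_addxx.
apply/forallP=> n; under eq_bigr do rewrite /entry mxE.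
under [X in _ == X]eq_bigr do rewrite /entry mxE.
by rewrite !sumr_const !card_ord; apply/eqP/val_inj.
Qed.

Definition Omega_code : code := Code allone_golay.

Definition grey : {set code} := [set d : code |
  [forall n, forall m, forall m',
     (m != ord0) && (m' != ord0) ==> (entry d m n == entry d m' n)]].

Definition coloured : {set code} := [set d : code |
  [forall n, (entry d ord0 n == 0) &&
             (#|[set m | entry d m n != 0]| \in [:: 0; 2]%N)]].

Definition grey_dual : {set cocode} :=
  [set delta | [forall h in coloured, pairing h delta == 0]].

Definition g_vec (i : 'I_6) : vec :=
  \row_(k < 24) (if k %% 4 == 0 then k %/ 4 != i else k %/ 4 == i)%N%:R.

Lemma g_entry i m n :
  entry (g_vec i) m n = (if m == ord0 then n != i else n == i)%:R.
Proof.
rewrite /entry mxE /= [(m + _)%N]addnC mulnC modnMDl divnMDl // modn_small //.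
by rewrite divn_small // addn0.
Qed.

Lemma g_golay i : g_vec i \in golay.
Proof.
rewrite inE; apply/andP; split.
  rewrite (_ : hexa _ = 0) ?mem0v //; apply/rowP=> n; rewrite !mxE.
  rewrite big_mkcond !big_ord_recl big_ord0 /= !g_entry /= /row_label /=.
  rewrite if_same add0r addr0; case: (n == i); rewrite /= ?addr0 //.
  by rewrite -[X in _ + X]/(alpha + alpha ^+ 2) F4_sum_labels F4_addxx.
apply/forallP=> n; under eq_bigr do rewrite g_entry.
under [X in _ == X]eq_bigr do rewrite g_entry eqxx.
rewrite -[\sum_(k < 6) _]natr_sum (bigD1 i) //= eqxx.
rewrite (eq_bigr (fun=> 1%N)) => [|k ki]; last by rewrite ki.
rewrite sum_nat_const cardC1 card_ord muln1 !big_ord_recl big_ord0 /=.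
by case: (n == i); apply/eqP/val_inj.
Qed.

Definition g_ (i : 'I_6) : code := Code (g_golay i).
Definition gamma_ (i : 'I_6) : cocode := coclass (delta_mx 0 (mog ord0 i)).
Definition omega : cocode := \sum_i gamma_ i.

(* Over F_2 a coefficient vector is the set I of indices where it is nonzero;
   the value outside grey (resp. grey_dual) is irrelevant. *)
Definition gweight (d : code) : nat :=
  #|odflt set0 [pick I : {set 'I_6} | d == \sum_(i in I) g_ i]|.
Definition gweight_dual (delta : cocode) : nat :=
  #|odflt set0 [pick I : {set 'I_6} | delta == \sum_(i in I) gamma_ i]|.
Definition w2 (d : code) : 'F_2 := 'C(gweight d, 2)%:R.
Definition w2_dual (delta : cocode) : 'F_2 := 'C(gweight_dual delta, 2)%:R.

Definition gamma (d : code) : cocode :=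
  \sum_(i | (2 <= #|[set m | (m != ord0) && (entry d m i != 0%R)]|)%N) gamma_ i.

Definition ipair (d e : code) : 'F_2 := pairing d (gamma e).

Definition Ppow (d : code) : 'F_2 := (wt d %/ 4)%:R.
Definition Ccomm (d e : code) : 'F_2 := (wt (cap d e) %/ 2)%:R.
Definition Aassoc (d e f : code) : 'F_2 := (wt (cap (cap d e) f))%:R.
Definition Acap (d e : code) : cocode := coclass (cap d e).

(* thetaC d is the element theta(d) of the cocode, theta d e the bit
   theta(d, e). *)
Record parker_cocycle (theta : code -> code -> 'F_2) (thetaC : code -> cocode) :
    Prop := {
  theta_diag : forall d, theta d d = Ppow d;
  theta_comm : forall d e, theta d e + theta e d = Ccomm d e;
  theta_addl : forall d e f, theta (d + e) f = theta d f + theta e f + Aassoc d e f;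
  theta_addr : forall d e f, theta d (e + f) = theta d e + theta d f;
  thetaC_pairing : forall d e, pairing e (thetaC d) = theta d e;
  thetaC_Omega : forall d, thetaC (d + Omega_code) = thetaC d;
  thetaC_grey : forall e, e \in grey ->
    thetaC e = gamma e *~ ((gweight e)%:Z - 1) + omega *+ w2 e;
  theta_grey_coloured : forall e h, e \in grey -> h \in coloured -> theta e h = 0;
  theta_coloured_grey : forall e h, e \in grey -> h \in coloured ->
    theta h e = pairing e (gamma h)
}.

Definition loop : Type := (code * 'F_2)%type.
HB.instance Definition _ := Finite.on loop.

Section ParkerLoop.

Variable theta : code -> code -> 'F_2.

Definition lmul (d e : loop) : loop := (d.1 + e.1, d.2 + e.2 + theta d.1 e.1).
Definition lone : loop := (0, 0).
Definition lneg1 : loop := (0, 1).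
Definition lOmega : loop := (Omega_code, 0).
Definition lopp (d : loop) : loop := lmul lneg1 d.
Definition linv (d : loop) : loop := (d.1, d.2 + theta d.1 d.1).
Definition lexp (d : loop) (n : nat) : loop := iter n (lmul d) lone.

Lemma F2_addxx (a : 'F_2) : a + a = 0.
Proof. by case: (F2_case a) => ->; apply: val_inj. Qed.

Lemma code_addxx (d : code) : d + d = 0.
Proof. by apply/val_inj/rowP=> i; rewrite !mxE F2_addxx. Qed.

Lemma lmulV d : lmul d (linv d) = lone.
Proof. by rewrite /lmul /= code_addxx addrA F2_addxx add0r F2_addxx. Qed.

Lemma lmulVl d : lmul (linv d) d = lone.
Proof. by rewrite /lmul /= code_addxx [d.2 + _ + _]addrAC F2_addxx add0r F2_addxx. Qed.

End ParkerLoop.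

Definition lg (i : 'I_6) : loop := (g_ i, 0).

Definition loop_grey0 : {set loop} :=
  [set (\sum_(i in (I : {set 'I_6})) g_ i, 0 : 'F_2)
    | I in [set I : {set 'I_6} | (ord0 \notin I) && ~~ odd #|I|]].

Definition loop_coloured : {set loop} := [set d | d.1 \in coloured].

(* The presented group has order 2^25, so a group of that order which is
   generated by elements satisfying the relations is the presented group. *)
Record is_Qx (theta : code -> code -> 'F_2) (Q : finGroupType)
    (xl : loop -> Q) (xc : cocode -> Q) : Prop := {
  Qx_order : #|[set: Q]| = (2 ^ 25)%N;
  Qx_gen : (<<[set xl d | d : loop] :|: [set xc delta | delta : cocode]>>
             = [set: Q])%g;
  Qx_central : forall q : Q, commute (xl lneg1) q;
  Qx_loop_sqr : forall d, (xl d ^+ 2 = xl lneg1 ^+ Ppow d.1)%g;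
  Qx_cocode_sqr : forall delta, (xc delta ^+ 2 = 1)%g;
  Qx_loop_mul : forall d e,
    (xl d * xl e = xl (lmul theta d e) * xc (Acap d.1 e.1))%g;
  Qx_cocode_mul : forall delta eps, (xc delta * xc eps = xc (delta + eps)%R)%g;
  Qx_comm : forall d delta,
    ([~ xl d, xc delta] = xl lneg1 ^+ pairing d.1 delta)%g
}.

Section Rep4096.

Variables (R : realType) (theta : code -> code -> 'F_2).
Variable v : loop -> bool -> 'rV[R]_(2 ^ 12).

(* v d false is d_1^+ and v d true is d_1^-.  Modulo the relations, the 2^14
   vectors v d s reduce to 2^12 up to sign, so in dimension 2^12 a spanning
   family satisfies no further relation. *)
Record is_4096x : Prop := {
  v_opp : forall d s, v (lopp theta d) s = - v d s;
  v_OmegaP : forall d, v (lmul theta lOmega d) false = v d false;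
  v_OmegaN : forall d, v (lmul theta lOmega d) true = - v d true;
  v_span : (<<[seq v u.1 u.2 | u : loop * bool]>> = fullv)%VS
}.

(* d_1^[sigma] *)
Definition v_ (d : loop) (sigma : int) : 'rV[R]_(2 ^ 12) := v d (odd `|sigma|%N).

Variables (Q : finGroupType) (xl : loop -> Q) (xc : cocode -> Q).
Variable rho : mx_representation R [set: Q] (2 ^ 12).

(* Matrices act on row vectors from the right, as in the convention that
   products of operators are read from left to right. *)
Record is_Qx_action : Prop := {
  act_loop : forall e d s, v d s *m rho (xl e) = v (lmul theta (linv theta e) d) s;
  act_cocode_even : forall delta d s, ~~ coparity delta ->
    v d s *m rho (xc delta) = (-1) ^+ pairing d.1 delta *: v d s;
  act_cocode_odd : forall delta d s, coparity delta ->
    v d s *m rho (xc delta) = (-1) ^+ pairing d.1 delta *: v d (~~ s)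
}.

Variable thetaC : code -> cocode.

Definition xtilde (d : code) : Q := (xl (d, 0%R) * xc (thetaC d))%g.

Definition xi_gamma : 'M[R]_(2 ^ 12) :=
  8^-1 *: \sum_(eps in grey_dual) (-1) ^+ w2_dual eps *: rho (xc eps).

Definition xi_g : 'M[R]_(2 ^ 12) :=
  8^-1 *: \sum_(e in grey) (-1) ^+ w2 e *: rho (xtilde e).

Definition xi : 'M[R]_(2 ^ 12) := xi_gamma *m xi_g.

End Rep4096.

(* Main.v *)
Require Import Defs.
From mathcomp Require Import all_boot all_order all_algebra all_fingroup.
From mathcomp Require Import mxrepresentation reals.
From mathcomp Require Import qpoly qfpoly generic_quotient ring_quotient.
From mathcomp Require Import zify ring.

(** Write a grey word as the sum of the [g_ i] over a set [I] of columns, and an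
    element of the grey part of the cocode as the sum of the [gamma_ i] over a
    set [J].  Addition becomes symmetric difference, the weight becomes the
    cardinality, and [w2] becomes [quad : I |-> 'C(#|I|, 2)] mod 2.  The point
    is that [quad] is a quadratic form over F_2 ([quad_symd]) whose polar form
    is both the pairing of [I] with [J] ([pairing_grey]) and the form <<d, e>>
    ([ipair_grey]).  Hence everything reduces to completing squares in Gauss
    sums of [quad].

    Take a basis vector whose code word is the grey word of [I] plus a coloured
    word [h].  The summand of [xi_gamma] given by [J] multiplies it by
    (-1)^(quad J + polar I J) and exchanges the signs + and - if [#|J|] is odd.
    Substituting I + J for J extracts the factor (-1)^(quad I), and leaves the
    Gauss sums of [quad] over the even and over the odd subsets of a set of six
    elements, which are 0 and -8 ([gauss_sum6]).  So [xi_gamma] acts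
    monomially: [act_xi_gamma].

    In [xtilde e] the cocycle values contributed by x_e and by x_theta(e)
    cancel, so it translates the code word by [e] and changes nothing else
    ([act_xtilde]).  Therefore [xi_g] is a convolution with (-1)^quad over the
    64 grey words.  The relation for Omega identifies, up to sign, the vectors
    of [J] and of its complement; on half of the sets the two terms cancel, on
    the other half they agree, and g_0^b P_G^0 is a system of representatives
    for the latter ([act_xi_g_fold]).  Polarity of [quad] merges the phases of
    the two factors into the first formula ([act_xi]).  Applying it twice
    produces one more Gauss sum, over the 16 sets that index P_G^0, of value -4
    ([gauss_sum_twisted]), and this gives the second formula ([act_xi_sqr]).

    What must be known about the Golay code is that the grey words and the grey
    part of the cocode are parametrised by sets of columns as above ([greyP],
    [grey_dualP]), and that the pairing can be computed on any representative
    ([pairing_coclass]).  Both rest on one identity: the dot product of two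
    vectors is the trace of the Hermitian product of their images under [hexa]
    ([dot_herm], [dot_herm_row0]), and the hexacode is its own Hermitian
    complement ([hexacode_herm], [herm_hexacode]). *)

Set Implicit Arguments.
Unset Strict Implicit.
Unset Printing Implicit Defensive.

Import GRing.Theory.

Local Open Scope ring_scope.
Local Open Scope quotient_scope.

Local Notation abar := (alpha ^+ 2).

(** * The quadratic form on the subsets of a finite set *)

Lemma F2_natr_odd n : n%:R = (odd n)%:R :> 'F_2.
Proof.
by rewrite -{1}(odd_double_half n) natrD -addnn natrD F2_addxx addr0.
Qed.

Lemma F2_mulxx (a : 'F_2) : a * a = a.
Proof. by case: (F2_case a) => ->; rewrite ?mul0r ?mul1r. Qed.

Lemma F2_bool (c : bool) :
  ((c%:R == 1 :> 'F_2) = c) * ((c%:R == 0 :> 'F_2) = ~~ c).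
Proof. by case: c. Qed.

Lemma F2_signD (R : pzRingType) (a b : 'F_2) :
  (-1) ^+ (a + b)%R = (-1) ^+ a * (-1) ^+ b :> R.
Proof.
by case: (F2_case a) (F2_case b) => [->|->] [->|->];
  rewrite /= ?mul1r ?mulr1 // -expr2 sqrrN expr1n.
Qed.

Lemma F2_sign_nat (R : pzRingType) n : (-1) ^+ (n%:R : 'F_2) = (-1) ^+ n :> R.
Proof. by rewrite F2_natr_odd -[RHS]signr_odd; case: (odd n). Qed.

Section SymmetricDifference.

Variable T : finType.
Implicit Types A B C : {set T}.

Definition symd A B : {set T} := [set x | (x \in A) (+) (x \in B)].
Local Notation "A :+: B" := (symd A B) (at level 50, left associativity).

Lemma in_symd A B x : (x \in A :+: B) = (x \in A) (+) (x \in B).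
Proof. by rewrite inE. Qed.

Lemma symdC A B : A :+: B = B :+: A.
Proof. by apply/setP=> x; rewrite !in_symd addbC. Qed.

Lemma symd0 A : A :+: set0 = A.
Proof. by apply/setP=> x; rewrite !in_symd inE addbF. Qed.

Lemma symdK B : involutive (symd B).
Proof. by move=> A; apply/setP=> x; rewrite !in_symd addbA addbb addFb. Qed.

Lemma symd_setC A B : ~: A :+: B = ~: (A :+: B).
Proof. by apply/setP=> x; rewrite !inE addNb. Qed.

Lemma card_symd A B : (#|A :+: B| + #|A :&: B|.*2 = #|A| + #|B|)%N.
Proof.
have -> : A :+: B = (A :\: B) :|: (B :\: A).
  by apply/setP=> x; rewrite !inE; case: (x \in A); case: (x \in B).
rewrite cardsU (_ : _ :&: _ = set0) ?cards0 ?subn0; last first.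
  by apply/setP=> x; rewrite !inE; case: (x \in A); case: (x \in B).
rewrite -[in RHS](cardsID B A) -[in RHS](cardsID A B) [B :&: A]setIC.
by rewrite -addnn addnACA ![(_ + #|A :&: B|)%N]addnC.
Qed.

Lemma odd_card_symd A B : odd #|A :+: B| = odd #|A| (+) odd #|B|.
Proof.
by have /(congr1 odd) := card_symd A B; rewrite !oddD odd_double addbF.
Qed.

Lemma sum_symd (V : zmodType) (F : T -> V) (F2 : forall i, F i + F i = 0) A B :
  \sum_(i in A :+: B) F i = \sum_(i in A) F i + \sum_(i in B) F i.
Proof.
rewrite !(big_mkcond (fun i => i \in _)) -big_split /=; apply: eq_bigr => i _.
by rewrite in_symd; case: (i \in A); case: (i \in B);
  rewrite /= ?addr0 ?add0r ?F2.
Qed.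

(** The F_2-valued form that [w2] induces on sets of indices; [polar] is its
    polar form by [quad_symd]. *)
Definition quad A : 'F_2 := 'C(#|A|, 2)%:R.
Definition polar A B : 'F_2 := (#|A| * #|B| + #|A :&: B|)%:R.

Lemma bin2_add m n : 'C(m + n, 2) = ('C(m, 2) + 'C(n, 2) + m * n)%N.
Proof.
elim: m => [|m IHm]; first by rewrite bin0n mul0n addn0 !add0n.
by rewrite addSn !binS !bin1 IHm mulSn; lia.
Qed.

Lemma F2_bin2_double m : 'C(m.*2, 2)%:R = m%:R :> 'F_2.
Proof.
by rewrite -addnn bin2_add !natrD F2_addxx add0r natrM F2_mulxx.
Qed.

(** Both sides come from expanding 'C(n, 2) at the two sides of
    |A + B| + 2 |A :&: B| = |A| + |B|, since 'C(2 m, 2) = m mod 2. *)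
Lemma quad_symd A B : quad (A :+: B) = quad A + quad B + polar A B.
Proof.
have /(congr1 (fun n => 'C(n, 2)%:R : 'F_2)) := card_symd A B.
rewrite !bin2_add !natrD F2_bin2_double natrM -addnn natrD F2_addxx mulr0 addr0.
move=> E; apply: (addIr #|A :&: B|%:R).
by rewrite E /polar natrD -!addrA F2_addxx addr0.
Qed.

Lemma card_symd_F2 A B : #|A :+: B|%:R = #|A|%:R + #|B|%:R :> 'F_2.
Proof. by rewrite -natrD -card_symd natrD -addnn natrD F2_addxx addr0. Qed.

Lemma polarC A B : polar A B = polar B A.
Proof. by rewrite /polar mulnC setIC. Qed.

Lemma polarDl A B C : polar (A :+: B) C = polar A C + polar B C.
Proof.
have -> : polar (A :+: B) C =
    #|A :+: B|%:R * #|C|%:R + #|(A :&: C) :+: (B :&: C)|%:R.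
  rewrite /polar natrD natrM; congr (_ + #|pred_of_set _|%:R).
  by apply/setP=> x; rewrite !inE andb_addl.
by rewrite !card_symd_F2 mulrDl addrACA /polar !natrD !natrM.
Qed.

Lemma polarDr A B C : polar A (B :+: C) = polar A B + polar A C.
Proof. by rewrite polarC polarDl !(polarC _ A). Qed.

Lemma polarxx A : polar A A = 0.
Proof. by rewrite /polar setIid natrD natrM F2_mulxx F2_addxx. Qed.

Lemma sum_subsets_card (V : zmodType) (S : {set T}) (F : nat -> V) :
  \sum_(A : {set T} | A \subset S) F #|A|
    = \sum_(k < #|S|.+1) F k *+ 'C(#|S|, k).
Proof.
rewrite (partition_big (fun A : {set T} => inord #|A| : 'I_#|S|.+1) predT) //=.
apply: eq_bigr => k _.
have E (A : {set T}) : (A \subset S) && (inord #|A| == k) =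
    (A \in [set B : {set T} | B \subset S & #|B| == k]).
  rewrite inE; case AS: (A \subset S) => //=.
  by rewrite -val_eqE /= inordK // ltnS subset_leq_card.
rewrite (eq_bigl _ _ E) (eq_bigr (fun=> F k)); last first.
  by move=> A; rewrite inE => /andP[_ /eqP->].
by rewrite sumr_const cards_draws.
Qed.

Lemma sum_symd_reindex (V : nmodType) (F : {set T} -> V) B :
  \sum_A F A = \sum_A F (B :+: A).
Proof. by rewrite (reindex_inj (can_inj (symdK B))). Qed.

(** The case of a set and its complement, whose sizes add up to [#|T|].  It
    gives the phase that multiplication by Omega introduces. *)
Lemma quad_setC A :
  quad (~: A) = quad A + 'C(#|T|, 2)%:R + #|A|%:R * (#|T|%:R + 1).
Proof.
rewrite -(cardsC A) bin2_add !natrD natrM -/(quad A) -/(quad (~: A)).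
(* What remains is an identity between elements of F_2. *)
move: (quad A) (quad _) #|A|%:R #|~: A|%:R => a b c d.
by case: (F2_case a) (F2_case b) (F2_case c) (F2_case d)
  => [->|->] [->|->] [->|->] [->|->]; apply: val_inj.
Qed.

End SymmetricDifference.

Notation "A :+: B" := (symd A B) (at level 50, left associativity).

(** * Gauss sums of the quadratic form *)

(** The summand depends on the cardinality only, so the sum is an alternating
    sum of binomial coefficients. *)
Lemma gauss_sum_subsets (R : pzRingType) (T : finType) (S : {set T})
    (p : bool) :
  \sum_(A : {set T} | (A \subset S) && (odd #|A| == p)) (-1) ^+ quad A
  = \sum_(k < #|S|.+1)
      ((if odd k == p then (-1) ^+ 'C(k, 2) else 0) : R) *+ 'C(#|S|, k).
Proof.
pose F k : R := if odd k == p then (-1) ^+ 'C(k, 2) else 0.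
rewrite -(sum_subsets_card S F) /F.
rewrite big_mkcondr; apply: eq_bigr => A _.
by rewrite /quad F2_sign_nat.
Qed.

(** The values are 1 - 15 + 15 - 1 and 6 - 20 + 6: real and imaginary part of
    (1 + i)^6, as (-1)^'C(k, 2) is i^k for even k and i^(k - 1) for odd k. *)
Lemma gauss_sum6 (R : comNzRingType) (p : bool) :
  \sum_(A : {set 'I_6} | odd #|A| == p) (-1) ^+ quad A =
    (if p then - 8 else 0 : R).
Proof.
transitivity (\sum_(A : {set 'I_6} | (A \subset [set: 'I_6]) && (odd #|A| == p))
   (-1) ^+ quad A : R).
  by apply: eq_bigl => A; rewrite subsetT.
rewrite gauss_sum_subsets cardsT card_ord !big_ord_recr big_ord0 /=.
rewrite !(bin0, bin1, binn) bin0n.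
have -> : 'C(1, 2) = 0%N by [].
have -> : 'C(6, 2) = 15%N by [].
have -> : 'C(6, 3) = 20%N by [].
have -> : 'C(6, 4) = 15%N by [].
have -> : 'C(6, 5) = 6%N by [].
have -> : 'C(3, 2) = 3%N by [].
have -> : 'C(4, 2) = 6%N by [].
have -> : 'C(5, 2) = 10%N by [].
by case: p => /=; ring.
Qed.

(** The set of columns that indexes the code word of [g_0 ^ b]. *)
Definition g0_support (b : bool) : {set 'I_6} := if b then [set ord0] else set0.

Definition grey0_support : pred {set 'I_6} :=
  [pred E : {set 'I_6} | (ord0 \notin E) && ~~ odd #|E|].

(** Translation by [g0_support b] turns the indices of P_G^0 into the sets
    for which both the membership of the column 0 and the parity are given by
    [b]. *)
Lemma grey0_support_shift b E :
  ((ord0 \in g0_support b :+: E) == b) && (odd #|g0_support b :+: E| == b)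
  = grey0_support E.
Proof.
rewrite /grey0_support /= odd_card_symd in_symd /g0_support.
by case: b; rewrite ?cards1 ?cards0 ?inE ?eqxx /=;
  case: (ord0 \in E); case: odd.
Qed.

Lemma quad_g0_support b : quad (g0_support b) = 0.
Proof. by rewrite /quad; case: b; rewrite ?cards1 ?cards0. Qed.

Lemma polar_g0_support b E : grey0_support E -> polar (g0_support b) E = 0.
Proof.
move=> /andP[E0 /negPf oE].
rewrite /polar natrD natrM ![#|E|%:R]F2_natr_odd oE mulr0 add0r.
rewrite (_ : _ :&: _ = set0) ?cards0 //; apply/setP=> x.
rewrite !inE /g0_support; case: b; rewrite ?inE //.
by case: eqVneq => [->|] //=; apply: negPf.
Qed.

Lemma polar_g0_support2 b c : polar (g0_support b) (g0_support c) = 0.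
Proof.
case: b c => [] []; rewrite ?polarxx //.
all: rewrite /polar cards0 ?setI0 ?set0I cards0.
all: by rewrite ?muln0 ?mul0n.
Qed.

(** The two phases of xi: the first term comes from [xi_gamma], the second
    from [xi_g].  By polarity the dependence on [quad] of the source cancels,
    and the powers of g_0 drop out because they are orthogonal to everything
    that occurs. *)
Lemma quad_xi_phase (k s : bool) D E : grey0_support D -> grey0_support E ->
  quad (g0_support k :+: D) + quad (g0_support s :+: E :+: (g0_support k :+: D))
  = polar D E + quad E.
Proof.
move=> eD eE; rewrite (quad_symd (_ :+: E)) (quad_symd _ E) quad_g0_support.
have -> : polar (g0_support s :+: E) (g0_support k :+: D) = polar D E.
  rewrite polarDl !polarDr polar_g0_support2 polar_g0_support //.
  by rewrite [polar E (g0_support k)]polarC polar_g0_support // !add0r polarC.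
rewrite polar_g0_support // addr0 add0r.
by rewrite -[RHS]addr0 -(F2_addxx (quad (g0_support k :+: D))); ring.
Qed.

(** The value is 1 - 10 + 5, over the even subsets of five columns. *)
Lemma gauss_sum5 (R : comNzRingType) :
  \sum_(A : {set 'I_6} | grey0_support A) (-1) ^+ quad A = - 4 :> R.
Proof.
transitivity (
  \sum_(A : {set 'I_6} | (A \subset [set~ ord0]) && (odd #|A| == false))
   (-1) ^+ quad A : R).
  by apply: eq_bigl => A; rewrite subsetC sub1set inE eqbF_neg.
rewrite gauss_sum_subsets cardsC1 card_ord !big_ord_recr big_ord0 /=.
rewrite !(bin0, bin1, binn) bin0n.
have -> : 'C(5, 2) = 10%N by [].
have -> : 'C(5, 4) = 5%N by [].
have -> : 'C(4, 2) = 6%N by [].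
by ring.
Qed.

(** Complete the square: substitute E + (D + F) for E, which preserves the
    range of summation. *)
Lemma gauss_sum_twisted (R : comNzRingType) D F :
  grey0_support D -> grey0_support F ->
  \sum_(E | grey0_support E) (-1) ^+ (polar D E + quad E + polar E F)%R
   = - 4 * (-1) ^+ (quad D + quad F + polar D F)%R :> R.
Proof.
move=> eD eF; rewrite -quad_symd.
set G := D :+: F; rewrite (reindex_inj (can_inj (symdK G))).
have eG E : grey0_support (G :+: E) = grey0_support E.
  have /andP[D0 oD] := eD; have /andP[F0 oF] := eF.
  rewrite /grey0_support /= !odd_card_symd !in_symd (negPf D0) (negPf F0).
  by rewrite (negPf oD) (negPf oF).
rewrite (eq_bigl _ _ eG) (eq_bigr (fun E => (-1) ^+ quad G * (-1) ^+ quad E)).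
  by rewrite -mulr_sumr mulrC gauss_sum5.
move=> E _; rewrite -F2_signD.
suff -> : polar D (G :+: E) + quad (G :+: E) + polar (G :+: E) F =
  quad G + quad E by [].
rewrite [polar _ F]polarC addrAC -polarDl -/G quad_symd polarDr polarxx add0r.
by rewrite addrC -addrA F2_addxx addr0.
Qed.

(** * The field of four elements and its trace *)

(** Elements of the quotient are polynomials of degree at most 1, so that an
    element is given by its two coordinates in F_2. *)
Lemma F4_coord (z : F4) : z = (val z)`_0 *: 1 + (val z)`_1 *: alpha.
Proof.
have sz : (size (val z) <= 2)%N.
  rewrite -ltnS; apply: leq_trans (size_mk_monic z) _.
  by rewrite (mk_monicE F4_polyP) size_F4_poly.
transitivity (in_qpoly F4_poly (val z)).
  by apply: val_inj; rewrite /= [RHS]in_qpoly_small // size_mk_monic.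
have -> : (1 : F4) = in_qpoly F4_poly 1 by rewrite rmorph1.
rewrite -!in_qpolyZ -in_qpolyD; congr in_qpoly.
apply/polyP=> i; rewrite coefD !coefZ coef1 coefX.
case: i => [|[|i]] /=; rewrite ?mulr0 ?mulr1 ?addr0 ?add0r //.
by rewrite nth_default // (leq_trans sz).
Qed.

Lemma F4_1alpha : 1 + alpha = abar.
Proof. by rewrite -F4_sum_labels addrAC F4_addxx add0r. Qed.

Lemma F4_case (z : F4) : [\/ z = 0, z = 1, z = alpha | z = abar].
Proof.
have := F4_coord z.
case: (F2_case (val z)`_0) => ->; case: (F2_case (val z)`_1) => ->.
- by rewrite !scale0r addr0; constructor 1.
- by rewrite scale0r scale1r add0r; constructor 3.
- by rewrite scale0r scale1r addr0; constructor 2.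
- by rewrite !scale1r F4_1alpha; constructor 4.
Qed.

Lemma F4_abar1 : 1 + abar = alpha.
Proof. by rewrite -F4_1alpha addrA F4_addxx add0r. Qed.

Lemma F4_alpha_abar : alpha * abar = 1.
Proof. by rewrite -F4_1alpha mulrDr mulr1 -expr2 F4_sum_labels. Qed.

Lemma F4_abar2 : abar * abar = alpha.
Proof. by rewrite {1}expr2 -mulrA F4_alpha_abar mulr1. Qed.

Lemma alpha_neq0 : alpha != 0.
Proof.
by apply: contraNneq (oner_neq0 F4) => a0; rewrite -F4_alpha_abar a0 mul0r.
Qed.

Lemma alpha_neq1 : alpha != 1.
Proof.
apply: contraNneq (oner_neq0 F4) => a1.
by rewrite -F4_sum_labels a1 expr1n F4_addxx.
Qed.

Lemma abar_neq0 : abar != 0.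
Proof. exact: expf_neq0 alpha_neq0. Qed.

Lemma abar_neq1 : abar != 1.
Proof.
by apply: contraNneq alpha_neq0 => b1; rewrite -F4_abar1 b1 F4_addxx.
Qed.

Lemma abar_neq_alpha : abar != alpha.
Proof.
apply: contraNneq (oner_neq0 F4) => ba.
by rewrite -F4_sum_labels [X in _ + X]ba F4_addxx.
Qed.

Definition F4_table :=
  (F4_1alpha, F4_abar1, F4_sum_labels, F4_alpha_abar, F4_abar2).

(** The entries of the tables that differ from those of [F4_table] by
    commutativity; with both, closed expressions rewrite to one of 0, 1,
    alpha, abar. *)
Lemma F4_tableC :
  (alpha + 1 = abar) * (abar + 1 = alpha) * (abar + alpha = 1) *
  (abar * alpha = 1) * (alpha * alpha = abar).
Proof. by rewrite ![_ + alpha]addrC ![_ + 1]addrC !F4_table mulrC F4_table. Qed.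

(** The trace z + z^2 of F_4 over F_2, with its values read in F_2. *)
Definition trace4 (z : F4) : 'F_2 := (z + z ^+ 2 != 0)%:R.

Lemma trace4_0 : trace4 0 = 0.
Proof. by rewrite /trace4 expr0n addr0 eqxx. Qed.

Lemma trace4_1 : trace4 1 = 0.
Proof. by rewrite /trace4 expr1n F4_addxx eqxx. Qed.

Lemma trace4_alpha : trace4 alpha = 1.
Proof. by rewrite /trace4 F4_sum_labels oner_neq0. Qed.

Lemma trace4_abar : trace4 abar = 1.
Proof.
by rewrite /trace4 [X in _ + X]expr2 F4_abar2 addrC F4_sum_labels oner_neq0.
Qed.

Definition trace4E := (trace4_0, trace4_1, trace4_alpha, trace4_abar).

Lemma trace4D z w : trace4 (z + w) = trace4 z + trace4 w.
Proof.
case: (F4_case z) => ->; case: (F4_case w) => ->.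
all: by rewrite ?(addr0, add0r, F4_addxx, F4_table, F4_tableC) ?trace4E
  ?(addr0, add0r, F2_addxx).
Qed.

(** * The dot product as the trace of a Hermitian form *)

Definition label_sum (x : 'I_4 -> 'F_2) : F4 := \sum_(m | x m == 1) row_label m.

(** On the three rows with nonzero labels: distinct labels have Hermitian
    product of trace 1, equal ones of trace 0, which is the identity matrix up
    to the all-one matrix. *)
Lemma label_rows_dot (x1 x2 x3 y1 y2 y3 : 'F_2) :
  let f (a b c : 'F_2) : F4 :=
    (if a == 1 then 1 else 0) +
      ((if b == 1 then alpha else 0) + (if c == 1 then abar else 0)) in
  x1 * y1 + (x2 * y2 + x3 * y3) =
    trace4 (f x1 x2 x3 * (f y1 y2 y3 * f y1 y2 y3)) +
      (x1 + (x2 + x3)) * (y1 + (y2 + y3)).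
Proof.
move=> f.
have fE a b c : f a b c = (if a == 1 then 1 else 0) +
      ((if b == 1 then alpha else 0) + (if c == 1 then abar else 0)) by [].
have e01 : (0 == 1 :> 'F_2) = false by [].
case: (F2_case x1) (F2_case x2) (F2_case x3) => [->|->] [->|->] [->|->].
all: case: (F2_case y1) (F2_case y2) (F2_case y3) => [->|->] [->|->] [->|->].
all: rewrite !fE ?eqxx ?e01 {f fE}.
all: rewrite ?(addr0, add0r, F4_addxx, F4_table, F4_tableC).
all: rewrite ?(mulr0, mul0r, mulr1, mul1r, F4_table, F4_tableC, trace4E).
all: by apply: val_inj.
Qed.

Lemma label_sumE x : label_sum x =
  (if x (inord 1) == 1 then 1 else 0) +
    ((if x (inord 2) == 1 then alpha else 0) +
     (if x (inord 3) == 1 then abar else 0)).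
Proof.
rewrite /label_sum big_mkcond !big_ord_recl big_ord0 /= /row_label /= addr0.
rewrite if_same add0r; congr (_ + (_ + _)); congr (if _ == _ then _ else _);
  by congr x; apply: val_inj; rewrite /= inordK.
Qed.

Lemma sum_rows (V : nmodType) (F : 'I_4 -> V) : \sum_m F m =
  F ord0 + (F (inord 1) + (F (inord 2) + F (inord 3))).
Proof.
rewrite !big_ord_recl big_ord0 /= addr0; congr (_ + (_ + (_ + _)));
  by congr F; apply: val_inj; rewrite /= inordK.
Qed.

(** The label of row 0 is zero, so its entries only occur next to the column
    parities. *)
Lemma column_dot (x y : 'I_4 -> 'F_2) :
  \sum_m x m * y m =
    trace4 (label_sum x * label_sum y ^+ 2) +
    (x ord0 * \sum_m y m + y ord0 * \sum_m x m + (\sum_m x m) * \sum_m y m).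
Proof.
rewrite !label_sumE !sum_rows label_rows_dot -expr2.
(* What remains is an identity between elements of F_2. *)
set t := trace4 _; move: (_ + (_ + _)) (_ + (_ + _)) (x _) (y _) t.
move=> p q a b t.
by case: (F2_case a) (F2_case b) (F2_case p) (F2_case q) (F2_case t)
  => [->|->] [->|->] [->|->] [->|->] [->|->]; apply: val_inj.
Qed.

Lemma sum_mog (V : nmodType) (F : 'I_24 -> V) :
  \sum_k F k = \sum_n \sum_m F (mog m n).
Proof.
rewrite exchange_big pair_big /=.
rewrite (reindex (fun p : 'I_4 * 'I_6 => mog p.1 p.2)) //=.
exists (fun k : 'I_24 => (inord (k %% 4), inord (k %/ 4))) => [[m n]|k] _ /=.
  have := ltn_ord m; have := ltn_ord n => n6 m4.
  by congr pair; apply: val_inj; rewrite /= inordK; lia.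
by have k24 := ltn_ord k; apply: val_inj; rewrite /= !inordK; lia.
Qed.

Lemma mog_surj (k : 'I_24) : exists m n, k = mog m n.
Proof.
exists (inord (k %% 4)), (inord (k %/ 4)).
by have k24 := ltn_ord k; apply: val_inj; rewrite /= !inordK; lia.
Qed.

Lemma vec_entryP (x y : vec) : (forall m n, entry x m n = entry y m n) -> x = y.
Proof.
move=> E; apply/rowP=> k; have [m [n ->]] := mog_surj k; exact: E.
Qed.

Definition dot (x y : vec) : 'F_2 := \sum_k x 0 k * y 0 k.

Lemma dotE x y : dot x y = \sum_n \sum_m entry x m n * entry y m n.
Proof. exact: sum_mog. Qed.

Lemma dotDr x y z : dot x (y + z) = dot x y + dot x z.
Proof. by rewrite -big_split; apply: eq_bigr => k _; rewrite mxE mulrDr. Qed.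

Lemma dotC x y : dot x y = dot y x.
Proof. by apply: eq_bigr => k _; rewrite mulrC. Qed.

Lemma wt_F2 (x : vec) : (wt x)%:R = \sum_k x 0 k.
Proof.
rewrite /wt -sum1_card natr_sum big_mkcond; apply: eq_bigr => k _.
by rewrite inE; case: (F2_case (x 0 k)) => ->.
Qed.

Lemma wt_cap x y : (wt (cap x y))%:R = dot x y.
Proof. by rewrite wt_F2; apply: eq_bigr => k _; rewrite mxE. Qed.

Lemma hexaE x n : hexa x 0 n = label_sum (fun m => entry x m n).
Proof. by rewrite mxE. Qed.

(** The Hermitian product, squaring being the conjugation of F_4. *)
Definition herm (a b : 'rV[F4]_6) : F4 := \sum_n a 0 n * b 0 n ^+ 2.

Lemma trace4_sum (I : finType) (F : I -> F4) :
  trace4 (\sum_i F i) = \sum_i trace4 (F i).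
Proof. exact: (big_morph trace4 trace4D trace4_0). Qed.

(** The parity condition in the definition of the Golay code. *)
Definition balanced (x : vec) : Prop :=
  forall n, \sum_m entry x m n = \sum_k entry x ord0 k.

Lemma golayP x : reflect (hexa x \in hexacode /\ balanced x) (x \in golay).
Proof.
rewrite inE; apply: (iffP andP) => -[hx px]; split=> //.
  by move=> n; apply/eqP; move/forallP: px.
by apply/forallP=> n; rewrite px.
Qed.

(** Summed over the six columns, the parity terms of [column_dot] become
    pq + qp + 6pq = 0, where p and q are the common parities. *)
Lemma dot_herm x y : balanced x -> balanced y ->
  dot x y = trace4 (herm (hexa x) (hexa y)).
Proof.
move=> px py; rewrite dotE trace4_sum.
under eq_bigr => n _ do rewrite column_dot px py -!hexaE.
rewrite big_split /= !big_split /= -!mulr_suml sumr_const card_ord.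
rewrite -[RHS]addr0; congr (_ + _).
move: (\sum_k _) (\sum_k _) => p q.
by case: (F2_case p) (F2_case q) => [->|->] [->|->]; apply: val_inj.
Qed.

(** Here the parity terms vanish in each column separately, which allows an
    arbitrary [x]. *)
Lemma dot_herm_row0 x y : (forall n, entry y ord0 n = 0) -> balanced y ->
  dot x y = trace4 (herm (hexa x) (hexa y)).
Proof.
move=> y0 py; rewrite dotE trace4_sum; apply: eq_bigr => n _.
rewrite column_dot py y0 big1 => [|k _]; last exact: y0.
by rewrite !mulr0 mul0r !addr0 -!hexaE.
Qed.

(** * The hexacode is its own Hermitian complement *)

(** Parity checks, read off from the systematic generator matrix. *)
Lemma hexacodeP (a : 'rV[F4]_6) : reflect
  [/\ a 0 (inord 3) = a 0 (inord 0) + a 0 (inord 1) + a 0 (inord 2),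
      a 0 (inord 4) =
        abar * a 0 (inord 0) + alpha * a 0 (inord 1) + a 0 (inord 2)
    & a 0 (inord 5) =
        alpha * a 0 (inord 0) + abar * a 0 (inord 1) + a 0 (inord 2)]
  (a \in hexacode).
Proof.
rewrite /hexacode span_def !big_cons big_nil addv0; apply: (iffP memv_addP).
  case=> _ /vlineP[c0 ->]
    [_ /memv_addP[_ /vlineP[c1 ->] [_ /vlineP[c2 ->] ->]] ->].
  by split; rewrite !mxE !inordK //= !(mulr0, mulr1, addr0, add0r) addrA
     ?[abar * _]mulrC ?[alpha * _]mulrC.
case=> e3 e4 e5.
exists (a 0 (inord 0) *: \row_(j < 6) [:: 1; 0; 0; 1; abar; alpha]`_j).
  by apply/vlineP; eexists.
exists (a 0 (inord 1) *: (\row_(j < 6) [:: 0; 1; 0; 1; alpha; abar]`_j) +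
        a 0 (inord 2) *: (\row_(j < 6) [:: 0; 0; 1; 1; 1; 1]`_j)).
  by apply/memv_addP; do 2![eexists; first by apply/vlineP; eexists].
apply/rowP=> j; have -> : j = inord j by rewrite inord_val.
case: j => [[|[|[|[|[|[|//]]]]]] /= ltj]; rewrite !mxE ?inordK //= ?e3 ?e4 ?e5
  ?(mulr0, mulr1, addr0, add0r) //.
all: by rewrite addrA ?[_ * abar]mulrC ?[_ * alpha]mulrC.
Qed.

Lemma sum_columns (V : nmodType) (F : 'I_6 -> V) : \sum_n F n =
  F (inord 0) + (F (inord 1) + (F (inord 2) +
    (F (inord 3) + (F (inord 4) + F (inord 5))))).
Proof.
rewrite !big_ord_recl big_ord0 /= addr0; congr (_ + (_ + (_ + (_ + (_ + _)))));
  by congr F; apply: val_inj; rewrite /= inordK.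
Qed.

Lemma F4_sqrD (z w : F4) : (z + w) ^+ 2 = z ^+ 2 + w ^+ 2.
Proof. by rewrite sqrrD -mulr_natr -natr1 mulrDr mulr1 F4_addxx addr0. Qed.

(** After the parity checks are substituted, each coefficient is a multiple of
    1 + 1, 1 + abar + abar^2 or 1 + alpha + abar, all of them zero. *)
Lemma hexacode_herm a b :
  a \in hexacode -> b \in hexacode -> herm a b = 0.
Proof.
move=> /hexacodeP[a3 a4 a5] /hexacodeP[b3 b4 b5].
rewrite /herm sum_columns a3 a4 a5 b3 b4 b5 !F4_sqrD !exprMn.
rewrite F4_abar2.
move: (a 0 _) (a 0 _) (a 0 _) (b 0 _ ^+ 2) (b 0 _ ^+ 2) (b 0 _ ^+ 2).
move=> z y x r q p.
have two0 := F4_addxx (1 : F4).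
transitivity (
    (1 + 1) * ((1 + alpha * abar) * (x * p + y * q) + (1 + 1) * (z * r))
   + (1 + (abar + abar * abar)) * (x * q + y * p)
   + (1 + (alpha + abar)) * (x * r + y * r + z * p + z * q)).
  by ring.
by rewrite F4_abar2 F4_tableC F4_sum_labels two0 !mul0r !addr0.
Qed.

(** Orthogonality to the three generators expresses the first three
    coordinates by the last three, and the right half of the generator matrix
    is unitary, so these relations can be inverted into the parity checks. *)
Lemma herm_hexacode (a : 'rV[F4]_6) :
  (forall b, b \in hexacode -> herm a b = 0) -> a \in hexacode.
Proof.
move=> orth.
have h0 : herm a (\row_(j < 6) [:: 1; 0; 0; 1; abar; alpha]`_j) = 0.
  by apply: orth; apply: memv_span; rewrite !inE eqxx.
have h1 : herm a (\row_(j < 6) [:: 0; 1; 0; 1; alpha; abar]`_j) = 0.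
  by apply: orth; apply: memv_span; rewrite !inE eqxx orbT.
have h2 : herm a (\row_(j < 6) [:: 0; 0; 1; 1; 1; 1]`_j) = 0.
  by apply: orth; apply: memv_span; rewrite !inE eqxx !orbT.
move: h0 h1 h2; rewrite /herm !sum_columns !mxE !inordK //=.
rewrite !expr0n !expr1n /= !(mulr0, mulr1, add0r, addr0).
rewrite [abar ^+ 2]expr2 F4_abar2.
have addI (z w : F4) : z + w = 0 -> z = w.
  by move/(congr1 (+%R^~ w)); rewrite -addrA F4_addxx addr0 add0r.
move=> /addI h0 /addI h1 /addI h2; apply/hexacodeP; rewrite h0 h1 h2.
move: (a 0 _) (a 0 _) (a 0 _) => x y z.
have k1 : 1 + (alpha + abar) = 0 by rewrite F4_sum_labels F4_addxx.
have k2 : 1 + (abar + abar * abar) = 0 by rewrite F4_abar2 F4_tableC F4_addxx.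
split.
- transitivity (z + (1 + 1) * z + (1 + (alpha + abar)) * (x + y)); last by ring.
  by rewrite k1 F4_addxx !mul0r !addr0.
- transitivity ((1 + (alpha + abar)) * z + (1 + (1 + 1) * (alpha * abar)) * y
                + (1 + (abar + abar * abar)) * x); last by ring.
  by rewrite k1 k2 F4_addxx !mul0r !addr0 add0r mul1r.
- transitivity ((1 + (alpha + abar)) * z + (1 + (1 + 1) * (alpha * abar)) * x
                + (1 + (abar + abar * abar)) * y); last by ring.
  by rewrite k1 k2 F4_addxx !mul0r !addr0 add0r mul1r.
Qed.

Lemma golay_self_orthogonal x y : x \in golay -> y \in golay -> dot x y = 0.
Proof.
move=> /golayP[hx px] /golayP[hy py].
by rewrite dot_herm // hexacode_herm // trace4_0.
Qed.

(** Some multiple of a nonzero [z] has trace 1, and squares exhaust the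
    field. *)
Lemma trace4_nondegenerate z : (forall c, trace4 (z * c ^+ 2) = 0) -> z = 0.
Proof.
case: (F4_case z) => -> // tr0.
- by have := tr0 abar; rewrite mul1r expr2 F4_abar2 trace4_alpha => /eqP.
- by have := tr0 1; rewrite expr1n mulr1 trace4_alpha => /eqP.
- by have := tr0 1; rewrite expr1n mulr1 trace4_abar => /eqP.
Qed.

(** * Coloured words as lifts of hexacode words *)

(** In each column the preimage of a label that vanishes in row 0 and has even
    weight: the label is the sum of the two other nonzero ones. *)
Definition lift_hexa (b : 'rV[F4]_6) : vec :=
  \row_(k < 24) [&& (k %% 4 != 0)%N, b 0 (inord (k %/ 4)) != 0 &
                  b 0 (inord (k %/ 4)) != row_label (inord (k %% 4))]%:R.

Lemma entry_lift_hexa b m n : entry (lift_hexa b) m n =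
  [&& m != ord0, b 0 n != 0 & b 0 n != row_label m]%:R.
Proof.
rewrite /entry mxE /= [(m + _)%N]addnC mulnC modnMDl divnMDl // modn_small //.
by rewrite divn_small // addn0 !inord_val.
Qed.

Lemma lift_hexa_column b n :
  label_sum (fun m => entry (lift_hexa b) m n) = b 0 n /\
  #|[set m | entry (lift_hexa b) m n != 0%R]| = (b 0%R n != 0%R).*2.
Proof.
rewrite label_sumE -sum1_card.
rewrite (eq_bigl (fun m => entry (lift_hexa b) m n != 0)) => [|m];
  last by rewrite inE.
rewrite big_mkcond sum_rows /=.
have nz k : (0 < k < 4)%N -> (inord k == ord0 :> 'I_4) = false.
  by case/andP=> k0 k4; rewrite -val_eqE /= inordK // eqn0Ngt k0.
rewrite !entry_lift_hexa !F2_bool /row_label !nz // !inordK //= !negbK.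
have ne := (negPf alpha_neq0, negPf alpha_neq1, negPf abar_neq0,
  negPf abar_neq1, negPf abar_neq_alpha, eq_sym alpha abar,
  eq_sym 1 alpha, eq_sym 1 abar, oner_eq0).
by case: (F4_case (b 0 n)) => ->; rewrite !(eqxx, ne) /=;
  rewrite ?(F4_tableC, F4_table, add0r, addr0).
Qed.

Lemma hexa_lift b : hexa (lift_hexa b) = b.
Proof. by apply/rowP=> n; rewrite hexaE (lift_hexa_column b n).1. Qed.

Lemma entry_lift_hexa0 b n : entry (lift_hexa b) ord0 n = 0.
Proof. by rewrite entry_lift_hexa eqxx. Qed.

Lemma balanced_lift b : balanced (lift_hexa b).
Proof.
move=> n; rewrite (eq_bigr (fun=> 0) (fun k _ => entry_lift_hexa0 b k)) big1_eq.
have -> : \sum_m entry (lift_hexa b) m n =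
    #|[set m | entry (lift_hexa b) m n != 0]|%:R.
  rewrite -sum1_card natr_sum [RHS]big_mkcond /=; apply: eq_bigr => m _ /=.
  by rewrite inE; case: (F2_case (entry (lift_hexa b) m n)) => ->.
by rewrite (lift_hexa_column b n).2 -addnn natrD F2_addxx.
Qed.

Lemma lift_hexa_golay b : b \in hexacode -> lift_hexa b \in golay.
Proof.
by move=> hb; apply/golayP; rewrite hexa_lift; split=> //; apply: balanced_lift.
Qed.

Lemma lift_hexa_coloured b (hb : b \in hexacode) :
  Code (lift_hexa_golay hb) \in coloured.
Proof.
rewrite inE; apply/forallP=> n; rewrite entry_lift_hexa0 eqxx.
by rewrite (lift_hexa_column b n).2; case: (b 0 n != 0).
Qed.

(** The coloured words lift all of the hexacode, which is closed under
    multiplication by scalars; so orthogonality to them forces the whole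
    Hermitian product to vanish and not only its trace. *)
Lemma coloured_dual x : (forall h : code, h \in coloured -> dot x h = 0) ->
  hexa x \in hexacode.
Proof.
move=> orth; apply: herm_hexacode => b hb.
apply: trace4_nondegenerate => c.
have hcb : c *: b \in hexacode by exact: memvZ.
rewrite -(orth _ (lift_hexa_coloured hcb)).
rewrite dot_herm_row0 /=; last exact: balanced_lift.
  rewrite hexa_lift /herm mulr_suml; congr trace4; apply: eq_bigr => n _.
  by rewrite [(c *: b) _ _]mxE exprMn -mulrA [X in _ * X]mulrC.
exact: entry_lift_hexa0.
Qed.

(** * Grey words as sets of columns *)

Definition grey_word (I : {set 'I_6}) : code := \sum_(i in I) g_ i.

Definition top_row (I : {set 'I_6}) : vec :=
  \sum_(i in I) delta_mx 0 (mog ord0 i).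

Lemma mog_inj m m' n n' : (mog m n == mog m' n') = (m == m') && (n == n').
Proof.
apply/eqP/andP=> [/(congr1 val) /= E|[/eqP-> /eqP->] //].
have := ltn_ord m; have := ltn_ord m' => ? ?.
by split; apply/eqP/val_inj => /=; lia.
Qed.

Lemma entry_top_row I m n :
  entry (top_row I) m n = ((m == ord0) && (n \in I))%:R.
Proof.
rewrite /entry /top_row summxE.
rewrite (eq_bigr (fun i => ((m == ord0) && (n == i))%:R)) => [|i _];
  last by rewrite mxE mog_inj.
case: (m == ord0) => /=; last by rewrite big1.
rewrite big_mkcond (bigD1 n) //= eqxx big1 ?addr0; last first.
  by move=> i /negPf ni; rewrite eq_sym ni if_same.
by case: (n \in I).
Qed.

Lemma entryD x y m n : entry (x + y) m n = entry x m n + entry y m n.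
Proof. by rewrite /entry mxE. Qed.

Lemma code_sum (T : finType) (P : pred T) (F : T -> code) :
  code_val (\sum_(i | P i) F i) = \sum_(i | P i) code_val (F i).
Proof. exact: (big_morph code_val (id1 := 0) (op1 := +%R)). Qed.

(** In row 0, [g_ i] has a one in the columns different from [i]. *)
Lemma entry_grey_word I m n : entry (grey_word I) m n =
  (if m == ord0 then #|I|%:R + (n \in I)%:R else (n \in I)%:R).
Proof.
have E : \sum_(i in I) (n == i)%:R = (n \in I)%:R :> 'F_2.
  rewrite big_mkcond (bigD1 n) //= eqxx big1 ?addr0; last first.
    by move=> i /negPf ni; rewrite eq_sym ni if_same.
  by case: (n \in I).
rewrite /entry code_sum summxE.
rewrite (eq_bigr (fun i => if m == ord0 then 1 + (n == i)%:R else (n == i)%:R)).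
  case: (m == ord0); last by [].
  by rewrite big_split /= sumr_const E.
move=> i _; rewrite -/(entry (g_ i) m n) g_entry; case: (m == ord0) => //.
by case: (n == i); apply: val_inj.
Qed.

Lemma vec_addxx (x : vec) : x + x = 0.
Proof. by apply/rowP=> k; rewrite !mxE F2_addxx. Qed.

(** Grey words adjust the rows 1, 2, 3; what is left lies in row 0. *)
Lemma rows_agree_decomp x :
  (forall n m, m != ord0 -> entry x m n = entry x (inord 1) n) ->
  exists I J, x = (grey_word I : vec) + top_row J.
Proof.
move=> ag; pose I := [set n | entry x (inord 1) n == 1].
exists I, [set n | entry (x + grey_word I) ord0 n == 1].
apply: vec_entryP => m n; rewrite entryD entry_grey_word entry_top_row !inE.
rewrite entryD entry_grey_word eqxx inE; case: eqVneq => [->|m0] /=; last first.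
  by rewrite addr0 ag //; case: (F2_case (entry x (inord 1) n)) => ->.
move: (#|_|%:R + _) (entry x ord0 n) => a b.
by case: (F2_case a) (F2_case b) => [->|->] [->|->]; apply: val_inj.
Qed.

(** The nonzero labels satisfy no relation except that their sum is zero. *)
Lemma hexa0_decomp x :
  hexa x = 0 -> exists I J, x = (grey_word I : vec) + top_row J.
Proof.
move=> hx; apply: rows_agree_decomp => n m m0.
have := hexaE x n; rewrite hx mxE label_sumE => /esym.
have [E1 [E2 E3]] : 1 <> 0 :> F4 /\ alpha <> 0 /\ abar <> 0.
  by do !split; apply/eqP; rewrite ?oner_neq0 ?alpha_neq0 ?abar_neq0.
have: m \in [:: inord 1; inord 2; inord 3].
  by case: m m0 => [[|[|[|[|//]]]] lt4] //= _;
    rewrite !inE -!val_eqE /= !inordK.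
rewrite !inE.
case: (F2_case (entry x (inord 1) n)) => e1;
  case: (F2_case (entry x (inord 2) n)) => e2;
  case: (F2_case (entry x (inord 3) n)) => e3;
  rewrite e1 e2 e3 ?eqxx /= ?(F4_tableC, F4_table, add0r, addr0) //.
all: move=> mem lab; try by [case: (E1 lab) | case: (E2 lab) | case: (E3 lab)].
all: by case/or3P: mem => /eqP->; rewrite ?e1 ?e2 ?e3.
Qed.

(** All columns have the parity of row 0, so the set is empty or full; but the
    full row 0 has even weight, against odd columns. *)
Lemma top_row_golay I : top_row I \in golay -> I = set0.
Proof.
move=> /golayP[_ par].
have col n : \sum_m entry (top_row I) m n = (n \in I)%:R.
  rewrite (bigD1 ord0) //= entry_top_row big1 ?addr0 // => m /negPf m0.
  by rewrite entry_top_row m0.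
have cst n : (n \in I) = (ord0 \in I).
  have := par n; rewrite -(par ord0) !col.
  by case: (n \in I); case: (ord0 \in I).
case I0: (ord0 \in I); last by apply/setP=> n; rewrite cst I0 inE.
have := par ord0; rewrite col I0 (eq_bigr (fun=> 1)) => [|n _].
  by rewrite sumr_const card_ord => /eqP.
by rewrite entry_top_row cst I0.
Qed.

Lemma grey_word_symd I J : grey_word (I :+: J) = grey_word I + grey_word J.
Proof. by apply: sum_symd => i; apply: code_addxx. Qed.

Lemma grey_word_inj : injective grey_word.
Proof.
move=> I J E; apply/setP=> n.
have: entry (grey_word I) (inord 1) n = entry (grey_word J) (inord 1) n.
  by rewrite E.
rewrite !entry_grey_word -val_eqE /= inordK //=.
by case: (n \in I); case: (n \in J).
Qed.

Lemma greyP d : reflect (exists I, d = grey_word I) (d \in grey).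
Proof.
apply: (iffP idP) => [|[I ->]]; rewrite inE; last first.
  apply/forallP=> n; apply/forallP=> m; apply/forallP=> m'; apply/implyP.
  by case/andP=> /negPf m0 /negPf m0'; rewrite !entry_grey_word m0 m0'.
move=> /forallP ag.
have [n m m0|I [J dE]] := @rows_agree_decomp d.
  move: (ag n) => /forallP/(_ m)/forallP/(_ (inord 1))/implyP E.
  by apply/eqP/E; rewrite m0 -val_eqE /= inordK.
exists I; apply/val_inj; rewrite /= dE (_ : J = set0) ?big_set0 ?addr0 //.
  by rewrite /top_row big_set0 addr0.
apply: top_row_golay.
have -> : top_row J = (d : vec) - grey_word I by rewrite dE addrAC subrr add0r.
by rewrite rpredB // code_valP.
Qed.

Lemma gweightE I : gweight (grey_word I) = #|I|.
Proof.
rewrite /gweight; case: pickP => [J /eqP/grey_word_inj <-|/(_ I)] //=.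
by rewrite eqxx.
Qed.

Lemma w2E I : w2 (grey_word I) = quad I.
Proof. by rewrite /w2 gweightE. Qed.

(** * The pairing and the grey part of the cocode *)

Lemma coclassE x y : coclass x = coclass y <-> x - y \in golay.
Proof. by rewrite /coclass Quotient.idealrBE; split=> /eqP. Qed.

Lemma coclassD x y : coclass (x + y) = coclass x + coclass y.
Proof. exact: raddfD. Qed.

Lemma coclass_repr (delta : cocode) : coclass (repr delta) = delta.
Proof. exact: reprK. Qed.

(** Self-orthogonality of the Golay code makes the choice of a representative
    immaterial. *)
Lemma pairing_coclass (d : code) x : pairing d (coclass x) = dot d x.
Proof.
rewrite /pairing wt_cap.
have : repr (coclass x) - x \in golay.
  by apply/coclassE; rewrite coclass_repr.
move=> /(golay_self_orthogonal (code_valP d)) E.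
by rewrite -[repr _](subrK x) dotDr E add0r.
Qed.

Lemma pairingDr d delta eps :
  pairing d (delta + eps) = pairing d delta + pairing d eps.
Proof.
rewrite -(coclass_repr delta) -(coclass_repr eps) -coclassD.
by rewrite !pairing_coclass dotDr.
Qed.

Lemma pairingDl d e delta :
  pairing (d + e) delta = pairing d delta + pairing e delta.
Proof.
rewrite -(coclass_repr delta) !pairing_coclass.
by rewrite dotC dotDr ![dot (repr _) _]dotC.
Qed.

Lemma pairing0r d : pairing d 0 = 0.
Proof. by apply: (addrI (pairing d 0)); rewrite -pairingDr !addr0. Qed.

(** The parity of a class is its pairing with the all-one word, which makes it
    additive. *)
Lemma coparityE delta : coparity delta = (pairing Omega_code delta == 1).
Proof.
rewrite /coparity /pairing (_ : cap _ _ = repr delta); last first.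
  by apply/rowP=> k; rewrite !mxE mul1r.
by rewrite F2_natr_odd F2_bool.
Qed.

Definition grey_coword (I : {set 'I_6}) : cocode := \sum_(i in I) gamma_ i.

Lemma grey_cowordE I : grey_coword I = coclass (top_row I).
Proof.
by rewrite /grey_coword /top_row (big_morph coclass coclassD (raddf0 _)).
Qed.

Lemma cocode_addxx (delta : cocode) : delta + delta = 0.
Proof.
by rewrite -(coclass_repr delta) -coclassD vec_addxx; apply: raddf0.
Qed.

Lemma grey_coword_symd I J :
  grey_coword (I :+: J) = grey_coword I + grey_coword J.
Proof. by apply: sum_symd => i; apply: cocode_addxx. Qed.

Lemma grey_coword_inj : injective grey_coword.
Proof.
move=> I J E; have : grey_coword (I :+: J) = 0.
  by rewrite grey_coword_symd E cocode_addxx.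
rewrite grey_cowordE -(raddf0 (\pi_cocode)) => /coclassE.
rewrite subr0 => /top_row_golay E0.
by rewrite -[J](symdK I) E0 symd0.
Qed.

Lemma gweight_dualE I : gweight_dual (grey_coword I) = #|I|.
Proof.
rewrite /gweight_dual; case: pickP => [J /eqP/grey_coword_inj <-|/(_ I)] //=.
by rewrite eqxx.
Qed.

Lemma w2_dualE I : w2_dual (grey_coword I) = quad I.
Proof. by rewrite /w2_dual gweight_dualE. Qed.

Lemma pairing_grey_coword (d : code) J :
  pairing d (grey_coword J) = \sum_(j in J) entry d ord0 j.
Proof.
rewrite grey_cowordE pairing_coclass dotE [RHS]big_mkcond.
apply: eq_bigr => n _.
rewrite (bigD1 ord0) //= entry_top_row big1 ?addr0.
  by case: (n \in J); rewrite ?mulr1 ?mulr0.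
by move=> m /negPf m0; rewrite entry_top_row m0 mulr0.
Qed.

Lemma pairing_coloured h J : h \in coloured -> pairing h (grey_coword J) = 0.
Proof.
rewrite inE => /forallP hc; rewrite pairing_grey_coword big1 // => j _.
by have /andP[/eqP] := hc j.
Qed.

(** The column [j] meets row 0 of [g_ i] unless [i = j]: hence the product of
    the sizes, corrected by the intersection. *)
Lemma pairing_grey I J : pairing (grey_word I) (grey_coword J) = polar I J.
Proof.
rewrite pairing_grey_coword /polar.
under eq_bigr do rewrite entry_grey_word eqxx.
rewrite big_split /= sumr_const -mulrnA natrD; congr (_ + _).
rewrite -sum1_card natr_sum [LHS]big_mkcond [RHS]big_mkcond.
by apply: eq_bigr => j _; rewrite inE; case: (j \in I); case: (j \in J).
Qed.

(** A class orthogonal to the coloured words is mapped into the hexacode; after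
    a coloured word and a grey word are subtracted, its representative lies in
    row 0. *)
Lemma grey_dualP delta :
  reflect (exists J, delta = grey_coword J) (delta \in grey_dual).
Proof.
apply: (iffP idP) => [|[J ->]]; rewrite inE; last first.
  by apply/forall_inP=> h hc; rewrite pairing_coloured.
move/forall_inP=> orth; set x := repr delta.
have hx : hexa x \in hexacode.
  apply: coloured_dual => h hc.
  by rewrite dotC -pairing_coclass coclass_repr; apply/eqP/orth.
have [|I [J xE]] := @hexa0_decomp (x - lift_hexa (hexa x)).
  by rewrite hexaB hexa_lift subrr.
exists J; rewrite -(coclass_repr delta) grey_cowordE; apply/coclassE.
rewrite -/x -[x](subrK (lift_hexa (hexa x))) xE addrAC addrK.
by rewrite rpredD ?code_valP // lift_hexa_golay.
Qed.

Lemma pairingMn d delta n : pairing d (delta *+ n) = pairing d delta *+ n.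
Proof.
elim: n => [|n IHn]; first exact: pairing0r.
by rewrite !mulrS pairingDr IHn.
Qed.

Lemma sum_imset_sets (V : nmodType) (T : finType) (A : {set T})
    (f : {set 'I_6} -> T) (F : T -> V) :
  injective f -> (forall x, reflect (exists I, x = f I) (x \in A)) ->
  \sum_(x in A) F x = \sum_I F (f I).
Proof.
move=> fI fP; have -> : A = f @: setT.
  apply/setP=> x; apply/fP/imsetP => -[I]; first by exists I.
  by move=> _ ->; exists I.
rewrite big_imset /=; last by move=> I J _ _; apply: fI.
by apply: eq_bigl => I; rewrite inE.
Qed.

Lemma gamma_grey I : gamma (grey_word I) = grey_coword I.
Proof.
rewrite /gamma /grey_coword; apply: eq_bigl => n.
case nI : (n \in I).
  rewrite (_ : [set m | _] = [set~ ord0]) ?cardsC1 ?card_ord //.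
  apply/setP=> m; rewrite !inE entry_grey_word nI.
  by case: (m == ord0).
rewrite (_ : [set m | _] = set0) ?cards0 //.
apply/setP=> m; rewrite !inE entry_grey_word nI.
by case: (m == ord0); rewrite //= eqxx.
Qed.

Lemma omegaE : omega = grey_coword [set: 'I_6].
Proof. by apply: eq_bigl => i; rewrite inE. Qed.

Lemma OmegaE : Omega_code = grey_word [set: 'I_6].
Proof.
apply/val_inj/vec_entryP=> m n; rewrite entry_grey_word inE cardsT card_ord.
rewrite /entry mxE; case: (m == ord0) => //; exact: val_inj.
Qed.

Lemma pairing_Omega J : pairing Omega_code (grey_coword J) = #|J|%:R.
Proof.
rewrite OmegaE pairing_grey /polar setTI cardsT card_ord.
by rewrite natrD natrM [6%:R](_ : _ = 0) ?mul0r ?add0r //; apply: val_inj.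
Qed.

Lemma coparity_grey_coword J : coparity (grey_coword J) = odd #|J|.
Proof. by rewrite coparityE pairing_Omega F2_natr_odd F2_bool. Qed.

Lemma ipair_grey I J : ipair (grey_word I) (grey_word J) = polar I J.
Proof. by rewrite /ipair gamma_grey pairing_grey. Qed.

Lemma sum_loop_grey0 (V : nmodType) (F : loop -> V) :
  \sum_(e in loop_grey0) F e = \sum_(E | grey0_support E) F (grey_word E, 0).
Proof.
rewrite /loop_grey0 big_imset /=; last by move=> I J _ _ [/grey_word_inj].
by apply: eq_bigl => E; rewrite inE.
Qed.

(** * The action of xi on the module *)

Section Action.

Variables (R : realType) (theta : code -> code -> 'F_2).
Variable thetaC : code -> cocode.
Hypothesis Htheta : parker_cocycle theta thetaC.
Variables (Q : finGroupType) (xl : loop -> Q) (xc : cocode -> Q).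
Variable v : loop -> bool -> 'rV[R]_(2 ^ 12).
Hypothesis Hv : is_4096x theta v.
Variable rho : mx_representation R [set: Q] (2 ^ 12).
Hypothesis Hrho : is_Qx_action theta v xl xc rho.

Lemma theta0l c : theta 0 c = 0.
Proof.
have := theta_addl Htheta 0 0 c.
rewrite F2_addxx /Aassoc wt_cap dotE big1 ?addr0 // => n _.
by rewrite big1 // => m _; rewrite /entry !mxE !mul0r.
Qed.

Lemma v_sign c lam mu s : v (c, lam + mu) s = (-1) ^+ mu *: v (c, lam) s.
Proof.
case: (F2_case mu) => ->; first by rewrite addr0 scale1r.
have := v_opp Hv (c, lam) s.
by rewrite /lopp /lmul /= theta0l addr0 add0r addrC => ->; rewrite scaleN1r.
Qed.

(** theta(Omega) = theta(0), as theta(d + Omega) = theta(d). *)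
Lemma theta_Omega c : theta Omega_code c = 0.
Proof.
rewrite -(thetaC_pairing Htheta) -[Omega_code]add0r (thetaC_Omega Htheta).
by rewrite (thetaC_pairing Htheta) theta0l.
Qed.

Lemma v_Omega c lam (s : bool) :
  v (Omega_code + c, lam) s = (-1) ^+ s *: v (c, lam) s.
Proof.
have -> : (Omega_code + c, lam) = lmul theta lOmega (c, lam).
  by rewrite /lmul /= add0r theta_Omega addr0.
case: s; first by rewrite (v_OmegaN Hv) scaleN1r.
by rewrite (v_OmegaP Hv) scale1r.
Qed.

Lemma pairing_thetaC_grey c I : pairing c (thetaC (grey_word I)) =
  pairing c (grey_coword I) *+ #|I| + pairing c (grey_coword I)
   + pairing c omega *+ quad I.
Proof.
have gI : grey_word I \in grey by apply/greyP; exists I.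
rewrite (thetaC_grey Htheta gI) gamma_grey gweightE w2E pairingDr pairingMn.
rewrite mulrzBr mulr1z -pmulrn.
have -> : - grey_coword I = grey_coword I.
  by apply/eqP; rewrite eq_sym -addr_eq0 cocode_addxx.
by rewrite pairingDr pairingMn.
Qed.

(** The parity of gamma(e) is w(e), and w (w - 1) is even; omega is even as
    there are six columns. *)
Lemma coparity_thetaC_grey I : coparity (thetaC (grey_word I)) = false.
Proof.
rewrite coparityE pairing_thetaC_grey omegaE !pairing_Omega cardsT card_ord.
have -> : 6%:R = 0 :> 'F_2 by apply: val_inj.
by rewrite mul0rn addr0 -[X in X + _]mulr_natr F2_mulxx F2_addxx.
Qed.

Lemma act_grey_coword c lam s J :
  v (c, lam) s *m rho (xc (grey_coword J)) =
    (-1) ^+ pairing c (grey_coword J) *: v (c, lam) (s (+) odd #|J|).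
Proof.
case oJ: (odd #|J|).
  by rewrite (act_cocode_odd Hrho) ?coparity_grey_coword // addbT.
by rewrite (act_cocode_even Hrho) ?coparity_grey_coword ?oJ // addbF.
Qed.

(** The cocycle contributes theta(e, e) + theta(e, c) to the product of the
    inverse of e with c, and the operator of theta(e) contributes the sign of
    theta(e, e + c), which is the same. *)
Lemma act_xtilde c lam s I :
  v (c, lam) s *m rho (xtilde xl xc thetaC (grey_word I)) =
    v (grey_word I + c, lam) s.
Proof.
rewrite /xtilde repr_mxM ?inE // mulmxA (act_loop Hrho) /linv /lmul /=.
rewrite (act_cocode_even Hrho) ?coparity_thetaC_grey //=.
rewrite (thetaC_pairing Htheta) (theta_addr Htheta) add0r.
set a := theta _ _; set b := theta _ c.
rewrite (_ : a + lam + b = lam + (a + b)); last by ring.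
by rewrite v_sign scalerA -F2_signD F2_addxx scale1r.
Qed.

(** Complete the square in the phase and use [gauss_sum6]. *)
Lemma act_xi_gamma I h lam (s : bool) : h \in coloured ->
  v (grey_word I + h, lam) s *m xi_gamma xc rho =
    - (-1) ^+ quad I *: v (grey_word I + h, lam) (s (+) ~~ odd #|I|).
Proof.
move=> hc; rewrite /xi_gamma -scalemxAr mulmx_sumr.
rewrite (sum_imset_sets _ grey_coword_inj grey_dualP).
set c := grey_word I + h.
have E J : v (c, lam) s
     *m ((-1) ^+ w2_dual (grey_coword J) *: rho (xc (grey_coword J)))
  = (-1) ^+ (quad J + polar I J)%R *: v (c, lam) (s (+) odd #|J|).
  rewrite -scalemxAr act_grey_coword scalerA -F2_signD w2_dualE.
  by rewrite pairingDl (pairing_coloured _ hc) addr0 pairing_grey.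
(* Completing the square: replace J by I + J. *)
rewrite (eq_bigr _ (fun J _ => E J)) {E} (sum_symd_reindex _ I).
have E J : (-1) ^+ (quad (I :+: J) + polar I (I :+: J))%R
     *: v (c, lam) (s (+) odd #|I :+: J|)
  = (-1) ^+ quad I *:
      ((-1) ^+ quad J *: v (c, lam) ((s (+) odd #|I|) (+) odd #|J|)).
  rewrite odd_card_symd addbA scalerA -F2_signD; congr (_ ^+ _ *: _).
  by rewrite quad_symd polarDr polarxx add0r -addrA F2_addxx addr0.
rewrite (eq_bigr _ (fun J _ => E J)) {E} -scaler_sumr.
rewrite (bigID (fun J : {set 'I_6} => odd #|J| == true)) /=.
rewrite (eq_bigr (fun J : {set 'I_6} =>
  (-1) ^+ quad J *: v (c, lam) (s (+) ~~ odd #|I|))).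
  rewrite -scaler_suml gauss_sum6.
  rewrite (eq_bigl (fun J : {set 'I_6} => odd #|J| == false)) => [|J];
    last by case: odd.
  rewrite (eq_bigr (fun J : {set 'I_6} =>
    (-1) ^+ quad J *: v (c, lam) (s (+) odd #|I|))).
    rewrite -scaler_suml gauss_sum6 scale0r addr0 !scalerA; congr (_ *: _).
    by field.
  by move=> J /eqP->; rewrite addbF.
by move=> J /eqP->; rewrite addbT -addbN.
Qed.

Lemma act_xi_g c lam s : v (c, lam) s *m xi_g xl xc rho thetaC =
  8^-1 *: \sum_J (-1) ^+ quad J *: v (grey_word J + c, lam) s.
Proof.
rewrite /xi_g -scalemxAr mulmx_sumr (sum_imset_sets _ grey_word_inj greyP).
congr (_ *: _); apply: eq_bigr => J _.
by rewrite -scalemxAr act_xtilde w2E.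
Qed.

(** Pair [J] with its complement, which amounts to multiplication by Omega.
    The two terms agree if [#|J|] has parity [b], and cancel otherwise.  Among
    the sets of parity [b], exactly one of each pair contains the column 0 if
    and only if [b] holds. *)
Lemma act_xi_g_fold (I : {set 'I_6}) h lam (s b : bool) :
  b = s (+) ~~ odd #|I| ->
  v (grey_word I + h, lam) s *m xi_g xl xc rho thetaC =
  4^-1 *: \sum_(E | grey0_support E) (-1) ^+ quad (g0_support b :+: E :+: I)
     *: v (grey_word (g0_support b :+: E) + h, lam) s.
Proof.
move=> bE; rewrite act_xi_g (sum_symd_reindex _ I).
pose F J := (-1) ^+ quad (J :+: I) *: v (grey_word J + h, lam) s.
have EF J : (-1) ^+ quad (I :+: J)
    *: v (grey_word (I :+: J) + (grey_word I + h), lam) s = F J.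
  by rewrite addrA -grey_word_symd [X in grey_word X]symdC symdK [I :+: J]symdC.
rewrite (eq_bigr _ (fun J _ => EF J)) {EF}.
have FC J : F (~: J) = if odd #|J| == b then F J else - F J.
  rewrite /F symd_setC quad_setC card_ord.
  have -> : grey_word (~: J) = Omega_code + grey_word J.
    rewrite OmegaE -grey_word_symd; congr grey_word; apply/setP=> x.
    by rewrite !inE addTb.
  rewrite -[_ + _ + h]addrA v_Omega scalerA.
  have -> : 'C(6, 2)%:R = 1 :> 'F_2 by apply: val_inj.
  have -> : 6%:R + 1 = 1 :> 'F_2 by apply: val_inj.
  rewrite mulr1 F2_natr_odd odd_card_symd -(F2_sign_nat R s) -F2_signD.
  set q := quad _; set w := v _ _.
  have -> : q + 1 + (odd #|J| (+) odd #|I|)%:R + s%:R =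
      if odd #|J| == b then q else q + 1.
    by rewrite bE; case: (F2_case q) => ->;
      case: (odd #|J|); case: (odd #|I|); case: (s); apply: val_inj.
  by case: (_ == b); rewrite // F2_signD mulrN1 scaleNr.
rewrite (bigID (fun J : {set 'I_6} => (ord0 \in J) == b)) /=.
rewrite [X in _ + X](reindex_inj (@setC_inj _)) /=.
rewrite [X in _ + X](eq_bigl (fun J : {set 'I_6} => (ord0 \in J) == b))
  => [|J]; last by rewrite inE; case: (_ \in _); case: (b).
rewrite -big_split /=.
rewrite (eq_bigr (fun J : {set _} =>
  if odd #|J| == b then 2 *: F J else 0)); last first.
  move=> J _; rewrite FC; case: (odd _ == b); last by rewrite subrr.
  by rewrite scaler_nat mulr2n.
rewrite -big_mkcondr (reindex_inj (can_inj (symdK (g0_support b)))) /=.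
rewrite (eq_bigl _ _ (grey0_support_shift b)) -scaler_sumr scalerA.
by congr (_ *: _); field.
Qed.

Lemma act_xi (k s : bool) D h lam : h \in coloured -> grey0_support D ->
  v (grey_word (g0_support k :+: D) + h, lam) s *m xi xl xc rho thetaC =
  4^-1 *: \sum_(E | grey0_support E) (-1) ^+ (polar D E + quad E + 1)%R
    *: v (grey_word (g0_support s :+: E) + h, lam) (s (+) ~~ k).
Proof.
move=> hc eD; have ok : odd #|g0_support k :+: D| = k.
  by have := eD; rewrite -(grey0_support_shift k) => /andP[_ /eqP].
rewrite /xi mulmxA act_xi_gamma // -scalemxAl ok.
rewrite (@act_xi_g_fold _ _ _ _ s); last first.
  by rewrite ok -addbA addbb addbF.
rewrite scalerA mulrC -scalerA scaler_sumr; congr (_ *: _).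
apply: eq_bigr => E eE.
by rewrite scalerA mulNr -F2_signD quad_xi_phase // [in RHS]F2_signD mulrN1.
Qed.

Lemma act_xi_sqr (k s : bool) D h lam : h \in coloured -> grey0_support D ->
  v (grey_word (g0_support k :+: D) + h, lam) s *m
     (xi xl xc rho thetaC *m xi xl xc rho thetaC) =
  4^-1 *: \sum_(F | grey0_support F) (-1) ^+ (polar D F + quad D + 1)%R
    *: v (grey_word (g0_support (s (+) ~~ k) :+: F) + h, lam) k.
Proof.
move=> hc eD; rewrite mulmxA act_xi // -scalemxAl mulmx_suml; congr (_ *: _).
rewrite (eq_bigr (fun E => 4^-1 *: \sum_(F | grey0_support F)
   (-1) ^+ (polar D E + quad E + polar E F)%R * (-1) ^+ quad F
     *: v (grey_word (g0_support (s (+) ~~ k) :+: F) + h, lam) k)); last first.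
  move=> E eE; rewrite -scalemxAl act_xi // scalerA mulrC -scalerA scaler_sumr.
  congr (_ *: _); apply: eq_bigr => F eF.
  (* The sign superscripts and powers of g_0 after the second application. *)
  have -> : s (+) ~~ k (+) ~~ s = k by case: (s); case: (k).
  rewrite scalerA -!F2_signD; congr ((-1) ^+ nat_of_ord _ *: _).
  by rewrite -[RHS]addr0 -(F2_addxx 1); ring.
rewrite -scaler_sumr exchange_big scaler_sumr; apply: eq_bigr => F eF.
rewrite -scaler_suml scalerA -mulr_suml gauss_sum_twisted //; congr (_ *: _).
rewrite -mulrA -F2_signD.
have -> : quad D + quad F + polar D F + quad F = polar D F + quad D.
  by rewrite -[RHS]addr0 -(F2_addxx (quad F)); ring.
by rewrite [in RHS]F2_signD; field.
Qed.

(** theta(g_0) = 0, since g_0 has weight 1: the coefficient w - 1 of gamma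
    and the coefficient w_2 of omega both vanish. *)
Lemma theta_g0_support b c : theta (grey_word (g0_support b)) c = 0.
Proof.
case: b; last by rewrite /grey_word big_set0 theta0l.
rewrite -(thetaC_pairing Htheta) pairing_thetaC_grey quad_g0_support.
rewrite mulr0n addr0.
by rewrite cards1 F2_addxx.
Qed.

Lemma lexp_g0 n : lexp theta (lg ord0) n = (grey_word (g0_support (odd n)), 0).
Proof.
have g0E : g_ ord0 = grey_word (g0_support true) by rewrite /grey_word big_set1.
elim: n => [|n IHn]; first by rewrite /lexp /= /grey_word big_set0.
rewrite /lexp iterS -/(lexp theta _ n) IHn /lmul /lg /=.
rewrite g0E theta_g0_support !addr0.
rewrite -grey_word_symd; congr (grey_word _, _); apply/setP=> x.
by rewrite in_symd /g0_support; case: (odd n); rewrite !inE ?addbb ?addbF.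
Qed.

(** No cocycle value arises, because theta(g_0) = 0 and theta vanishes on
    grey times coloured. *)
Lemma word_grey_word n D (h : loop) : h \in loop_coloured ->
  lmul theta (lmul theta (lexp theta (lg ord0) n) (grey_word D, 0)) h =
    (grey_word (g0_support (odd n) :+: D) + h.1, h.2).
Proof.
rewrite inE => hc; rewrite lexp_g0 /lmul /= theta_g0_support !add0r.
rewrite -grey_word_symd.
rewrite (theta_grey_coloured Htheta) ?addr0 //.
by apply/greyP; eexists.
Qed.

End Action.

Theorem corollary9p16
  (R : realType)
  (theta : code -> code -> 'F_2) (thetaC : code -> cocode)
  (Htheta : parker_cocycle theta thetaC)
  (Q : finGroupType) (xl : loop -> Q) (xc : cocode -> Q)
  (HQ : is_Qx theta xl xc)
  (v : loop -> bool -> 'rV[R]_(2 ^ 12))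
  (Hv : is_4096x theta v)
  (rho : mx_representation R [set: Q] (2 ^ 12))
  (Hrho : is_Qx_action theta v xl xc rho)
  (d h : loop) (Hd : d \in loop_grey0) (Hh : h \in loop_coloured)
  (kappa sigma : nat) (Hkappa : (kappa <= 1)%N) (Hsigma : (sigma <= 1)%N) :
  let g0 := lg ord0 in
  let word n c := lmul theta (lmul theta (lexp theta g0 n) c) h in
  let Xi := xi xl xc rho thetaC in
  v_ v (word kappa d) sigma *m Xi
    = 4^-1 *: \sum_(e in loop_grey0)
        (-1) ^+ (ipair d.1 e.1 + w2 e.1 + 1)%R
          *: v_ v (word sigma e) (kappa + sigma + 1)%N
  /\
  v_ v (word kappa d) sigma *m (Xi *m Xi)
    = 4^-1 *: \sum_(e in loop_grey0)
        (-1) ^+ (ipair d.1 e.1 + w2 d.1 + 1)%R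
          *: v_ v (word (kappa + sigma + 1)%N e) kappa.
Proof.
move=> g0 word Xi.
have hc : h.1 \in coloured by move: Hh; rewrite inE.
have [D] := imsetP Hd; rewrite inE => eD dE; rewrite {d Hd}dE -/(grey_word D).
have wordE n E : word n (grey_word E, 0) =
    (grey_word (g0_support (odd n) :+: E) + h.1, h.2).
  exact: (word_grey_word Htheta).
have oddE : odd (kappa + sigma + 1) = odd sigma (+) ~~ odd kappa.
  by rewrite !oddD addbT addbC addbN.
rewrite !sum_loop_grey0 /v_ /= wordE; split.
  rewrite (act_xi Htheta Hv Hrho) //; congr (_ *: _); apply: eq_bigr => E _.
  by rewrite wordE ipair_grey w2E oddE.
rewrite (act_xi_sqr Htheta Hv Hrho) //; congr (_ *: _); apply: eq_bigr => E _.
by rewrite wordE ipair_grey w2E oddE.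
Qed.
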